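(* Let $\{\alpha,\beta\} \in \{\{123,231\},\ \{123,312\},\ \{132,321\},\ \{213,321\}\}$. Then $s_n(\emptyset;\{\alpha,\beta\}) = 2n-5$ for all integers $n \geq 5$, and $s_4(\emptyset;\{\alpha,\beta\}) = 2$.
   Context: Let $S_n$ denote the set of permutations of $[n]=\{1,2,\dots,n\}$, written as words $\pi=\pi_1\pi_2\cdots\pi_n$. For a pattern $\alpha=\alpha_1\cdots\alpha_k \in S_k$ with $k \le n$, an occurrence of $\alpha$ in $\pi \in S_n$ is a choice of indices $i_1<i_2<\cdots<i_k$ such that $\pi_{i_1}\pi_{i_2}\cdots\pi_{i_k}$ is order-isomorphic to $\alpha$, i.e. $|\{m \in \{1,\dots,k\} : \pi_{i_m} \le \pi_{i_j}\}| = \alpha_j$ for every $j=1,\dots,k$. A permutation contains $\alpha$ exactly once if it has exactly one occurrence of $\alpha$. Patterns such as $123$ or $312$ are elements of $S_3$ written as words. For patterns $\alpha \neq \beta$ in $S_3$, $s_n(\emptyset;\{\alpha,\beta\})$ denotes the number of permutations $\pi \in S_n$ that contain exactly one occurrence of $\alpha$ and exactly one occurrence of $\beta$ (the symbol $\emptyset$ indicates that no pattern is required to be avoided). *)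

(* Defs.v *)
From mathcomp Require Import all_boot all_fingroup.

Set Implicit Arguments.
Unset Strict Implicit.
Unset Printing Implicit Defensive.

(* 'S_n permutes {0, ..., n-1}, whereas words use the letters 1, ..., n:
   the letter in position i + 1 of the word is (p i).+1. *)
Definition perm_word n (p : 'S_n) : seq nat := [seq (p i).+1 | i : 'I_n].

Definition perms_of_words k (ws : seq (seq nat)) : {set 'S_k} :=
  [set p : 'S_k | perm_word p \in ws].

Definition occurrence k n (a : 'S_k) (p : 'S_n) (f : {ffun 'I_k -> 'I_n}) : bool :=
  [forall i : 'I_k, forall j : 'I_k, (i < j) ==> (f i < f j)] &&
  [forall j : 'I_k, #|[set m : 'I_k | p (f m) <= p (f j)]| == (a j).+1].

Definition nb_occurrences k n (a : 'S_k) (p : 'S_n) : nat :=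
  #|[set f | occurrence a p f]|.

(* s_n(A; B): the permutations that avoid every pattern in A and contain every
   pattern in B exactly once. *)
Definition nb_perms k (n : nat) (A B : {set 'S_k}) : nat :=
  #|[set p : 'S_n | [forall a in A, nb_occurrences a p == 0] &&
                    [forall b in B, nb_occurrences b p == 1]]|.

(* Main.v *)
Require Import Defs.
From mathcomp Require Import all_boot all_fingroup zify.

(** Reversal and complement carry occurrences of a pattern to occurrences of the
    reversed or complemented pattern, and they carry each of the four pairs to
    {132, 321}; so it suffices to count the permutations with exactly one
    occurrence of 132 and exactly one occurrence of 321.

    View a permutation as a set of points (x t, y t) in the grid, and let
    a b c be the only 132 and d e f the only 321. These two triples must
    overlap, and their union is order-isomorphic to 2431, to 4132 or to 42513
    (lemma [core_cases]): any other relative position creates another 132 or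
    321. Let z be a point outside this union, the core. For the cores
    2431 and 42513 the uniqueness of the two occurrences leaves z no room except
    to the right of c and above b (lemmas [beyond_core2431] and
    [beyond_core42513]), so only the last point of 2431 can be separated from
    the rest of the core. Two such outer points are increasing, since a
    descent among them would form a second 132 with a
    (lemma [beyond_increasing]). As a permutation is determined by the relative
    order of its values (lemma [perm_eq_order]), the permutation is one of
    - 2 4 3 5 6 7 and so on, with the letter 1 inserted anywhere after the 3:
      n - 3 permutations, with core 2431;
    - the inverses of these: transposition of the grid fixes the patterns 132
      and 321 and exchanges the cores 2431 and 4132;
    - 4 2 5 1 3 6 7 and so on, when n >= 5.
    All of them do have one occurrence of each pattern, which gives 2 (n - 3)
    permutations, and one more as soon as n >= 5. *)

(** * Occurrences as order isomorphisms *)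

Definition rank {k} (g : 'I_k -> nat) (j : 'I_k) := #|[set m | g m <= g j]|.

Lemma leq_rank {k} (g : 'I_k -> nat) i j :
  (rank g i <= rank g j) = (g i <= g j).
Proof.
apply/idP/idP => [|le_ij].
  apply: contraLR; rewrite -!ltnNge => lt_ji; apply/proper_card/properP; split.
    by apply/subsetP=> m; rewrite !inE => /leq_trans; apply; apply: ltnW.
  by exists i; rewrite !inE // -ltnNge.
by apply/subset_leq_card/subsetP=> m; rewrite !inE => /leq_trans; apply.
Qed.

Lemma rank_perm {k} (a : 'S_k) j : rank (fun i => val (a i)) j = (a j).+1.
Proof.
rewrite /rank -(card_imset _ (@perm_inj _ a)) -[RHS]card_ord.
have wide_inj : injective (widen_ord (ltn_ord (a j))) by move=> u v [/val_inj].
rewrite -(card_codom wide_inj).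
apply: eq_card => v; apply/imsetP/codomP => [[m] | [w ->]].
  by rewrite inE -ltnS => le_m ->; exists (Ordinal le_m); apply: val_inj.
exists (a^-1%g (widen_ord (ltn_ord (a j)) w)); last by rewrite permKV.
by rewrite inE permKV /= -ltnS.
Qed.

(** The value of a permutation is determined by its rank, which depends on the
    relative order only. *)
Lemma perm_eq_order {n} (p q : 'S_n) :
  (forall i j, (p i <= p j) = (q i <= q j)) -> p = q.
Proof.
move=> pq; apply/permP=> j; apply/val_inj/succn_inj; rewrite -!rank_perm.
by apply: eq_card => m; rewrite !inE pq.
Qed.

(** The ranks prescribed by an occurrence are those of the letters of the
    pattern, and ranks compare as the values do. This form is the one that
    behaves well under the symmetries of the square. *)
Lemma occurrenceP {k n} (a : 'S_k) (p : 'S_n) (f : {ffun 'I_k -> 'I_n}) :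
  reflect ((forall i j : 'I_k, i < j -> f i < f j) /\
           (forall i j, (p (f i) <= p (f j)) = (a i <= a j)))
          (occurrence a p f).
Proof.
apply: (iffP andP) => [[/forallP f_incr /forallP f_rank] | [f_incr f_order]].
  split=> [i j | i j]; first exact/implyP/(forallP (f_incr i)).
  rewrite -(leq_rank (fun i => val (p (f i)))) /rank /=.
  by rewrite (eqP (f_rank i)) (eqP (f_rank j)) ltnS.
split; first by apply/forallP=> i; apply/forallP=> j; apply/implyP/f_incr.
apply/forallP=> j; rewrite -rank_perm; apply/eqP/eq_card=> m.
by rewrite !inE f_order.
Qed.

Definition rev_perm n : 'S_n := perm (@rev_ord_inj n).

Definition reversal {n} (p : 'S_n) : 'S_n := (rev_perm n * p)%g.
Definition complement {n} (p : 'S_n) : 'S_n := (p * rev_perm n)%g.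

Lemma ltn_rev_ord {n} (i j : 'I_n) : (rev_ord i < rev_ord j) = (j < i).
Proof. by have := ltn_ord i; have := ltn_ord j; rewrite /=; lia. Qed.

Lemma nb_occurrences_reversal {k n} (a : 'S_k) (p : 'S_n) :
  nb_occurrences (reversal a) (reversal p) = nb_occurrences a p.
Proof.
pose flip (f : {ffun 'I_k -> 'I_n}) := [ffun i => rev_ord (f (rev_ord i))].
have flipK : involutive flip.
  by move=> f; apply/ffunP=> i; rewrite !ffunE !rev_ordK.
rewrite /nb_occurrences -[RHS](on_card_preimset (onW_bij _ (inv_bij flipK))).
apply: eq_card => f; rewrite !inE.
apply/occurrenceP/occurrenceP => -[incr order].
  split=> i j; rewrite !ffunE.
    by move=> lt_ij; rewrite ltn_rev_ord incr // ltn_rev_ord.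
  by have := order (rev_ord i) (rev_ord j); rewrite !permM !permE !rev_ordK.
split=> i j.
  by move=> lt_ij; have := incr (rev_ord j) (rev_ord i);
    rewrite !ffunE !rev_ordK !ltn_rev_ord; apply.
have := order (rev_ord i) (rev_ord j).
by rewrite !ffunE !permM !permE !rev_ordK.
Qed.

Lemma nb_occurrences_complement {k n} (a : 'S_k) (p : 'S_n) :
  nb_occurrences (complement a) (complement p) = nb_occurrences a p.
Proof.
have leq_rev m (i j : 'I_m) : (rev_perm m i <= rev_perm m j) = (j <= i).
  by rewrite !permE leqNgt ltn_rev_ord -leqNgt.
apply: eq_card => f; rewrite !inE.
apply/occurrenceP/occurrenceP => -[incr order]; split=> // i j;
  by have := order j i; rewrite !permM !leq_rev.
Qed.

Lemma nb_perms_imset {k n} (phi : 'S_k -> 'S_k) (psi : 'S_n -> 'S_n)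
    (A B : {set 'S_k}) :
    injective psi ->
    (forall a p, nb_occurrences (phi a) (psi p) = nb_occurrences a p) ->
  nb_perms n (phi @: A) (phi @: B) = nb_perms n A B.
Proof.
move=> psi_inj occ_psi; rewrite /nb_perms.
rewrite -[LHS](on_card_preimset (onW_bij _ (injF_bij psi_inj))).
have forall_phi (D : {set 'S_k}) (m : nat) p :
    [forall a in phi @: D, nb_occurrences a (psi p) == m] =
    [forall a in D, nb_occurrences a p == m].
  apply/forall_inP/forall_inP => [occ a Da | occ _ /imsetP[a Da ->]].
    by rewrite -occ_psi occ ?imset_f.
  by rewrite occ_psi occ.
by apply: eq_card => p; rewrite !inE !forall_phi.
Qed.

Lemma nb_perms_reversal {k} n (A B : {set 'S_k}) :
  nb_perms n (reversal @: A) (reversal @: B) = nb_perms n A B.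
Proof.
exact: nb_perms_imset reversal reversal A B (mulgI _) nb_occurrences_reversal.
Qed.

Lemma nb_perms_complement {k} n (A B : {set 'S_k}) :
  nb_perms n (complement @: A) (complement @: B) = nb_perms n A B.
Proof.
exact: nb_perms_imset complement complement A B (mulIg _)
  nb_occurrences_complement.
Qed.

(** * Words *)

Lemma size_perm_word {n} (p : 'S_n) : size (perm_word p) = n.
Proof. by rewrite size_image card_ord. Qed.

Lemma nth_perm_word {n} (p : 'S_n) (i : 'I_n) :
  nth 0 (perm_word p) i = (p i).+1.
Proof. by rewrite (nth_map i) ?size_enum_ord // nth_ord_enum. Qed.

Lemma perm_word_inj {n} : injective (@perm_word n).
Proof.
move=> p q eq_pq; apply/permP=> i; apply/val_inj/succn_inj.
by rewrite -!nth_perm_word eq_pq.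
Qed.

Lemma perm_word_reversal {n} (p : 'S_n) :
  perm_word (reversal p) = rev (perm_word p).
Proof.
apply: (@eq_from_nth _ 0) => [|i]; rewrite ?size_rev !size_perm_word // => lt_i.
rewrite nth_rev size_perm_word // (nth_perm_word _ (Ordinal lt_i)).
rewrite -[n - i.+1]/(val (rev_ord (Ordinal lt_i))) nth_perm_word.
by rewrite permM permE.
Qed.

Lemma perm_word_complement {n} (p : 'S_n) :
  perm_word (complement p) = [seq n.+1 - v | v <- perm_word p].
Proof.
rewrite -map_comp; apply: eq_map => i /=.
by rewrite permM permE /=; have := ltn_ord (p i); lia.
Qed.

Lemma perms_of_words2 {k} (a b : 'S_k) :
  perms_of_words k [:: perm_word a; perm_word b] = [set a; b].
Proof. by apply/setP=> c; rewrite !inE !(inj_eq perm_word_inj). Qed.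

(** * Points in the grid *)

Definition only {T : Type} (P : T -> T -> T -> Prop) a b c :=
  P a b c /\ forall a' b' c', P a' b' c' -> [/\ a' = a, b' = b & c' = c].

Definition once {T : Type} (P : T -> T -> T -> Prop) :=
  exists a b c, only P a b c.

Lemma nb_occurrences1P {n} (a : 'S_3) (p : 'S_n)
    (P : 'I_n -> 'I_n -> 'I_n -> Prop) :
    (forall f, occurrence a p f <->
               P (f (inord 0)) (f (inord 1)) (f (inord 2))) ->
  nb_occurrences a p = 1 <-> once P.
Proof.
move=> occP.
pose f3 u v w : {ffun 'I_3 -> 'I_n} := [ffun i : 'I_3 => nth u [:: u; v; w] i].
have f3E u v w :
    [/\ f3 u v w (inord 0) = u, f3 u v w (inord 1) = v
      & f3 u v w (inord 2) = w].
  by rewrite !ffunE !inordK.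
have eq3 (f g : {ffun 'I_3 -> 'I_n}) :
    f (inord 0) = g (inord 0) -> f (inord 1) = g (inord 1) ->
    f (inord 2) = g (inord 2) -> f = g.
  move=> e0 e1 e2; apply/ffunP=> i; rewrite -(inord_val i).
  by case: i => [[|[|[|?]]] ?].
split=> [/eqP/cards1P[f occ_f] | [u [v [w [Puvw uniq_uvw]]]]].
  exists (f (inord 0)), (f (inord 1)), (f (inord 2)); split.
    by apply/occP; have := set11 f; rewrite -occ_f inE.
  move=> u v w Puvw; have [e0 e1 e2] := f3E u v w.
  have : f3 u v w \in [set f].
    by rewrite -occ_f inE; apply/occP; rewrite e0 e1 e2.
  by rewrite inE => /eqP <-; split.
apply/eqP/cards1P; exists (f3 u v w); have [e0 e1 e2] := f3E u v w.
apply/setP=> f; rewrite !inE; apply/idP/eqP => [/occP/uniq_uvw[f0 f1 f2] | ->].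
  by apply: eq3; rewrite ?(f0, f1, f2) ?(e0, e1, e2).
by apply/occP; rewrite e0 e1 e2.
Qed.

Section Points.
Context {n : nat}.
Implicit Types x y : 'S_n.

(** The coordinates of a point are given by two permutations, rather than taking
    the position as the point itself, so that exchanging x and y transposes the
    grid, i.e. inverts the permutation. *)
Definition occ132 x y (a b c : 'I_n) := x a < x b < x c /\ y a < y c < y b.
Definition occ321 x y (a b c : 'I_n) := x a < x b < x c /\ y c < y b < y a.

Lemma same_pointE x y (s t : 'I_n) : (x s = x t :> nat) <-> (y s = y t :> nat).
Proof. by split=> /val_inj/perm_inj ->. Qed.

Lemma neq_point x y (s t : 'I_n) :
  s != t -> (x s != x t :> nat) && (y s != y t :> nat).
Proof. by move=> st; rewrite !(inj_eq val_inj) !(inj_eq perm_inj) st. Qed.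

Lemma only132P {x y a b c} : only (occ132 x y) a b c ->
  forall s t u, x s < x t < x u -> y s < y u < y t ->
  x s = x a :> nat /\ x t = x b :> nat /\ x u = x c :> nat.
Proof. by move=> [_ uniq] s t u xs ys; have [//|-> -> ->] := uniq s t u. Qed.

Lemma only321P {x y a b c} : only (occ321 x y) a b c ->
  forall s t u, x s < x t < x u -> y u < y t < y s ->
  x s = x a :> nat /\ x t = x b :> nat /\ x u = x c :> nat.
Proof. by move=> [_ uniq] s t u xs ys; have [//|-> -> ->] := uniq s t u. Qed.

Lemma only132_swap {x y a b c} :
  only (occ132 x y) a b c -> only (occ132 y x) a c b.
Proof.
move=> [[xabc yabc] uniq]; split=> // a' b' c' [y' x'].
by have [//|-> -> ->] := uniq a' c' b'.
Qed.

Lemma only321_swap {x y a b c} :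
  only (occ321 x y) a b c -> only (occ321 y x) c b a.
Proof.
move=> [[xabc yabc] uniq]; split=> // a' b' c' [y' x'].
by have [//|-> -> ->] := uniq c' b' a'.
Qed.

(** How the two occurrences overlap: in order of abscissa, the core is a b c f
    of shape 2431, or d a b c of shape 4132, or d a b f c of shape 42513. *)
Lemma core_cases {x y a b c d e f} :
    only (occ132 x y) a b c -> only (occ321 x y) d e f ->
  [\/ [/\ d = b, e = c, x c < x f & y f < y a],
      [/\ e = b, f = c, x d < x a & y b < y d]
    | [/\ e = a, x b < x f < x c & y c < y d < y b]].
Proof.
move=> only132 only321.
have v132 := only132P only132; have v321 := only321P only321.
have [[x132 y132] _] := only132; have [[x321 y321] _] := only321.
have xy := @same_pointE x y.
have x_inj s t : x s = x t :> nat -> s = t by move/val_inj/perm_inj.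
(* If f is to the right of c and below it, then b c f is the 321. *)
have [/andP[xcf yfc]|hf] := boolP ((x c < x f) && (y f < y c)).
  have [||xb [xc xf]] := v321 b c f; try lia.
  have := v132 a b f; have := xy a f => ? ?.
  constructor 1; split; [exact: x_inj|exact: x_inj|done|lia].
(* Symmetrically, if d is to the left of b and above it, then d b c is. *)
have [/andP[xdb ybd]|hd] := boolP ((x d < x b) && (y b < y d)).
  have [||xd [xe xf]] := v321 d b c; try lia.
  have := v132 a d c; have := xy a d => ? ?.
  constructor 2; split; [exact: x_inj|exact: x_inj|lia|done].
(* Otherwise the core is 42513, and d lies to the left of b and below it. *)
have xdb : x d < x b.
  rewrite ltnNge; apply/negP => xbd.
  have xye := xy e a; have xyd := xy d b.
  have [yae | yea] := ltnP (y a) (y e).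
    have [ydb | ybd] := ltnP (y d) (y b).
      by have := v132 a b d; have := xy d c; lia.
    by have := v132 a d e; have := v132 a b e; have := xy e c; lia.
  have ybe : y e < y b by lia.
  have [xbd' | xdb'] := ltnP (x b) (x d); first by have := v321 b e f; lia.
  have [xec | xce] := ltnP (x c) (x e); first by have := v321 b c e; lia.
  have := v321 a e f; have := xy f c; have := xy e c; lia.
have ydb : y d < y b by have := xy d b; lia.
have xeb : x e < x b.
  rewrite ltnNge; apply/negP => xbe.
  by have := v321 b e f; have := xy e b; lia.
(* If e is below c, then e b c is a 132, whence e = a. *)
have [yec | yce] := ltnP (y e) (y c).
  have [||xe [_ _]] := v132 e b c; try lia.
  have yea : y e = y a :> nat by apply/xy.
  have ycd : y c < y d.
    by have := v132 d b c; have := xy d c; lia.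
  have xbf : x b < x f.
    by have := v132 f b c; have := xy f b; lia.
  constructor 3; split; [exact: x_inj | have := xy f c; lia | lia].
(* Otherwise d e c is the 321, and the place of a relative to e yields either
   the second 132 a e c or the second 321 d e a. *)
have yce' : y c < y e by have := xy e c; lia.
have [||_ [_ xf]] := v321 d e c; try lia.
by have := v132 a e c; have := v321 d e a; have := xy a e; lia.
Qed.

(** Anywhere else, z would form a second 132 or 321 with two points of the
    core. *)
Lemma beyond_core2431 {x y a b c f} z :
    only (occ132 x y) a b c -> only (occ321 x y) b c f -> y f < y a ->
  z = a \/ z = b \/ z = c \/ z = f \/ x c < x z /\ y b < y z.
Proof.
move=> only132 only321 yfa.
have v132 := only132P only132; have v321 := only321P only321.
have [[x132 y132] _] := only132; have [[x321 _] _] := only321.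
have [->|/(neq_point x y) za] := eqVneq z a; first by left.
have [->|/(neq_point x y) zb] := eqVneq z b; first by right; left.
have [->|/(neq_point x y) zc] := eqVneq z c; first by do 2!right; left.
have [->|/(neq_point x y) zf] := eqVneq z f; first by do 3!right; left.
do 4!right.
have xcz : x c < x z.
  rewrite ltnNge; apply/negP => xzc.
  have [xzb | xbz] := ltnP (x z) (x b).
    by have := v132 z b c; have := v321 z c f; lia.
  have [yza | yaz] := ltnP (y z) (y a).
    by have := v132 z c f; have := v321 b z f; have := v132 z f c; lia.
  by have := v132 a b z; have := v321 z c f; lia.
split=> //; rewrite ltnNge; apply/negP => yzb.
by have := v321 b c z; have := v132 a b z; lia.
Qed.

Lemma beyond_core42513 {x y a b c d f} z :
    only (occ132 x y) a b c -> only (occ321 x y) d a f ->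
    x b < x f < x c -> y c < y d < y b ->
  z = d \/ z = a \/ z = b \/ z = f \/ z = c \/ x c < x z /\ y b < y z.
Proof.
move=> only132 only321 xf yd.
have v132 := only132P only132; have v321 := only321P only321.
have [[x132 y132] _] := only132; have [[x321 y321] _] := only321.
have [->|/(neq_point x y) zd] := eqVneq z d; first by left.
have [->|/(neq_point x y) za] := eqVneq z a; first by right; left.
have [->|/(neq_point x y) zb] := eqVneq z b; first by do 2!right; left.
have [->|/(neq_point x y) zf] := eqVneq z f; first by do 3!right; left.
have [->|/(neq_point x y) zc] := eqVneq z c; first by do 4!right; left.
do 5!right.
have xaz : x a < x z.
  rewrite ltnNge; apply/negP => xza.
  by have := v321 z a f; have := v132 z b c; lia.
have yaz : y a < y z.
  by rewrite ltnNge; apply/negP => yza; have := v321 d a z; lia.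
have xcz : x c < x z.
  rewrite ltnNge; apply/negP => xzc.
  have [yzc | ycz] := ltnP (y z) (y c); last by have := v132 a z c; lia.
  by have := v132 z b c; have := v132 a b z; lia.
split=> //; rewrite ltnNge; apply/negP => yzb.
by have := v132 a b z; lia.
Qed.

(** Since a is below and to the left of z and z', a descent z z' would complete
    a to a second 132. *)
Lemma beyond_increasing {x y a b c z z'} :
    only (occ132 x y) a b c -> x c < x z -> y b < y z -> y b < y z' ->
  x z < x z' -> y z < y z'.
Proof.
move=> only132 xcz ybz ybz' xzz'; have v132 := only132P only132.
have [[x132 y132] _] := only132.
have xy := @same_pointE x y z z'.
rewrite ltnNge; apply/negP => yz'z.
by have := v132 a z z'; lia.
Qed.
End Points.

(** * The permutations beyond a core *)

(** The identity is a junk value, for functions that do not permute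
    {0, ..., n-1}. *)
Definition perm_of_fun n (f : nat -> nat) : 'S_n :=
  odflt 1%g [pick p : 'S_n | [forall i, p i == f i :> nat]].

Lemma perm_of_funE n (f : nat -> nat) :
    (forall i, i < n -> f i < n) ->
    (forall i j, i < n -> j < n -> f i = f j -> i = j) ->
  forall i, perm_of_fun n f i = f i :> nat.
Proof.
move=> f_lt f_inj i; rewrite /perm_of_fun.
case: pickP => [p /forallP/(_ i)/eqP // | none].
pose g (j : 'I_n) := Ordinal (f_lt j (ltn_ord j)).
have g_inj : injective g.
  by move=> j k [/f_inj e]; apply: val_inj; apply: e.
by have /forallP[] := none (perm g_inj) => j; rewrite permE.
Qed.

(** In 0-based notation, the word 2 4 3 5 6 7 and so on with its letter 1 in
    position j >= 3. *)
Definition moved_one j i :=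
  if i == 0 then 1 else if i == 1 then 3 else if i == 2 then 2 else
  if i < j then i.+1 else if i == j then 0 else i.

(** In 0-based notation; the default value of [nth] continues the word by fixed
    points. *)
Definition word42513 i := nth i [:: 3; 1; 4; 0; 2] i.

Lemma moved_oneE j i (v := moved_one j i) : 3 <= j ->
  i = 0 /\ v = 1 \/ i = 1 /\ v = 3 \/ i = 2 /\ v = 2 \/
  3 <= i < j /\ v = i.+1 \/ i = j /\ v = 0 \/ j < i /\ v = i.
Proof.
rewrite {}/v /moved_one => j3.
have [->|i0] := eqVneq i 0; first lia.
have [->|i1] := eqVneq i 1; first lia.
have [->|i2] := eqVneq i 2; first lia.
have [ij|ji|->] := ltngtP i j; lia.
Qed.

Lemma word42513E i (v := word42513 i) :
  i = 0 /\ v = 3 \/ i = 1 /\ v = 1 \/ i = 2 /\ v = 4 \/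
  i = 3 /\ v = 0 \/ i = 4 /\ v = 2 \/ 5 <= i /\ v = i.
Proof.
rewrite {}/v /word42513; case: i => [|[|[|[|[|i]]]]] /=; try lia.
by rewrite nth_nil; lia.
Qed.

Section Graph.
Context {n : nat}.
Implicit Types x y w : 'S_n.

Definition graph (f : nat -> nat) x y := forall t, y t = f (x t) :> nat.

(** It is enough to compare relative orders, so no position or value of the
    points outside the core has to be computed. *)
Lemma graph_of_order (f : nat -> nat) w x y :
    (forall i, w i = f i :> nat) ->
    (forall s t, (y s <= y t) = (f (x s) <= f (x t))) ->
  graph f x y.
Proof.
move=> wE order t.
suff -> : y = (x * w)%g by rewrite permM wE.
by apply: perm_eq_order => s u; rewrite order !permM !wE.
Qed.

Definition moved_one_perm j : 'S_n := perm_of_fun n (moved_one j).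
Definition perm42513 : 'S_n := perm_of_fun n word42513.

Lemma moved_one_permE j : 3 <= j < n ->
  forall i, moved_one_perm j i = moved_one j i :> nat.
Proof.
case/andP=> j3 jn; apply: perm_of_funE => [i lt_i | i k lt_i lt_k].
  by have := moved_oneE j i j3; lia.
by have := moved_oneE j i j3; have := moved_oneE j k j3; lia.
Qed.

Lemma perm42513E : 5 <= n -> forall i, perm42513 i = word42513 i :> nat.
Proof.
move=> n5; apply: perm_of_funE => [i lt_i | i k lt_i lt_k].
  by have := word42513E i; lia.
by have := word42513E i; have := word42513E k; lia.
Qed.

Lemma perm_preimage x i : i < n -> exists t, x t = i :> nat.
Proof. by move=> lt_i; exists (x^-1%g (Ordinal lt_i)); rewrite permKV. Qed.

(** All the other points are to the right of c, so a, b, c come first; f may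
    come anywhere later, and its abscissa is the position of the letter 1. *)
Lemma graph_moved_one {x y a b c f} :
    only (occ132 x y) a b c -> only (occ321 x y) b c f -> y f < y a ->
  3 <= x f < n /\ graph (moved_one (x f)) x y.
Proof.
move=> only132 only321 yfa.
have beyond z := beyond_core2431 z only132 only321 yfa.
have [[x132 y132] _] := only132; have [[x321 _] _] := only321.
have lt_n := ltn_ord (x f).
have [t0 xt0] := @perm_preimage x 0 ltac:(lia).
have [t1 xt1] := @perm_preimage x 1 ltac:(lia).
have [t2 xt2] := @perm_preimage x 2 ltac:(lia).
have beyondE z : [\/ x z = x a :> nat /\ y z = y a :> nat,
     x z = x b :> nat /\ y z = y b :> nat,
     x z = x c :> nat /\ y z = y c :> nat |
     x z = x f :> nat /\ y z = y f :> nat \/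
     x z != x f :> nat /\ x c < x z /\ y b < y z].
  have [<-|zf] := eqVneq z f; first by constructor 4; left.
  have [->|[->|[->|[e|?]]]] := beyond z.
  - by constructor 1.
  - by constructor 2.
  - by constructor 3.
  - by rewrite e eqxx in zf.
  by constructor 4; right; rewrite (inj_eq val_inj) (inj_eq perm_inj).
have xa : x a = 0 :> nat by case: (beyondE t0) => [|||[]]; lia.
have xb : x b = 1 :> nat by case: (beyondE t1) => [|||[]]; lia.
have xc : x c = 2 :> nat by case: (beyondE t2) => [|||[]]; lia.
have xf : 3 <= x f < n by lia.
split=> //; apply: (graph_of_order _ (moved_one_perm (x f))).
  exact: moved_one_permE.
have j3 : 3 <= x f by lia.
pose v z := moved_one (x f) (x z).
have point z : [\/ [/\ x z = 0 :> nat, v z = 1 & y z = y a :> nat],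
     [/\ x z = 1 :> nat, v z = 3 & y z = y b :> nat],
     [/\ x z = 2 :> nat, v z = 2 & y z = y c :> nat] |
     [/\ x z = x f :> nat, v z = 0 & y z = y f :> nat] \/
     [/\ 3 <= x z, y b < y z
       & x z < x f /\ v z = (x z).+1 \/ x f < x z /\ v z = x z]].
  have vz := moved_oneE (x f) (x z) j3; rewrite -/(v z) in vz.
  have [[xz yz]|[xz yz]|[xz yz]|[[xz yz]|[nxz [xz yz]]]] := beyondE z.
  - by constructor 1; split; lia.
  - by constructor 2; split; lia.
  - by constructor 3; split; lia.
  - by constructor 4; left; split; lia.
  by constructor 4; right; split; lia.
move=> s t; rewrite -!/(v _).
have xy := @same_pointE n x y s t.
have st : x s < x t -> x c < x s -> y b < y s -> y b < y t -> y s < y t.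
  by move=> *; apply: (beyond_increasing only132) => //.
have ts : x t < x s -> x c < x t -> y b < y s -> y b < y t -> y t < y s.
  by move=> *; apply: (beyond_increasing only132) => //.
move: (point s) (point t) => {beyond beyondE point xt0 xt1 xt2 x321 lt_n}.
move=> [||| []] [xs vs ys] [||| []] [xt vt yt]; lia.
Qed.

Lemma graph_42513 {x y a b c d f} :
    only (occ132 x y) a b c -> only (occ321 x y) d a f ->
    x b < x f < x c -> y c < y d < y b ->
  5 <= n /\ graph word42513 x y.
Proof.
move=> only132 only321 xf yd.
have beyond z := beyond_core42513 z only132 only321 xf yd.
have [[x132 y132] _] := only132; have [[x321 y321] _] := only321.
have lt_n := ltn_ord (x c).
have [t0 xt0] := @perm_preimage x 0 ltac:(lia).
have [t1 xt1] := @perm_preimage x 1 ltac:(lia).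
have [t2 xt2] := @perm_preimage x 2 ltac:(lia).
have [t3 xt3] := @perm_preimage x 3 ltac:(lia).
have [t4 xt4] := @perm_preimage x 4 ltac:(lia).
have xd : x d = 0 :> nat.
  by case: (beyond t0) => [e|[e|[e|[e|[e|?]]]]]; subst; lia.
have xa : x a = 1 :> nat.
  by case: (beyond t1) => [e|[e|[e|[e|[e|?]]]]]; subst; lia.
have xb : x b = 2 :> nat.
  by case: (beyond t2) => [e|[e|[e|[e|[e|?]]]]]; subst; lia.
have xf3 : x f = 3 :> nat.
  by case: (beyond t3) => [e|[e|[e|[e|[e|?]]]]]; subst; lia.
have xc : x c = 4 :> nat.
  by case: (beyond t4) => [e|[e|[e|[e|[e|?]]]]]; subst; lia.
have n5 : 5 <= n by lia.
split=> //; apply: (graph_of_order _ perm42513); first exact: perm42513E.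
pose v z := word42513 (x z).
have point z : [\/ [/\ x z = 0 :> nat, v z = 3 & y z = y d :> nat],
     [/\ x z = 1 :> nat, v z = 1 & y z = y a :> nat],
     [/\ x z = 2 :> nat, v z = 4 & y z = y b :> nat] |
   [\/ [/\ x z = 3 :> nat, v z = 0 & y z = y f :> nat],
     [/\ x z = 4 :> nat, v z = 2 & y z = y c :> nat] |
     [/\ 5 <= x z, v z = x z & y b < y z]]].
  have := word42513E (x z); rewrite -/(v z).
  case: (beyond z) => [e|[e|[e|[e|[e|?]]]]] vz; subst.
  - by constructor 1; split; lia.
  - by constructor 2; split; lia.
  - by constructor 3; split; lia.
  - by constructor 4; constructor 1; split; lia.
  - by constructor 4; constructor 2; split; lia.
  by constructor 4; constructor 3; split; lia.
move=> s t; rewrite -!/(v _).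
have xy := @same_pointE n x y s t.
have st : x s < x t -> x c < x s -> y b < y s -> y b < y t -> y s < y t.
  by move=> *; apply: (beyond_increasing only132) => //.
have ts : x t < x s -> x c < x t -> y b < y s -> y b < y t -> y t < y s.
  by move=> *; apply: (beyond_increasing only132) => //.
move: (point s) (point t) => {beyond point xt0 xt1 xt2 xt3 xt4 lt_n}.
move=> [||| []] [xs vs ys] [||| []] [xt vt yt]; lia.
Qed.

Lemma once_graph x y : once (occ132 x y) -> once (occ321 x y) ->
  [\/ exists2 j, 3 <= j < n & graph (moved_one j) x y,
      exists2 j, 3 <= j < n & graph (moved_one j) y x |
      5 <= n /\ graph word42513 x y].
Proof.
move=> [a [b [c only132]]] [d [e [f only321]]].
have [[? ? xcf yfa]|[? ? xda ybd]|[? xf yd]] := core_cases only132 only321;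
  subst.
- have [j3 g] := graph_moved_one only132 only321 yfa.
  by constructor 1; exists (x f).
- (* The transpose of a core 4132 is a core 2431. *)
  have only132V := only132_swap only132; have only321V := only321_swap only321.
  have [j3 g] := graph_moved_one only132V only321V xda.
  by constructor 2; exists (y d).
by constructor 3; apply: graph_42513 only132 only321 xf yd.
Qed.

Lemma once_preimage x (P : 'I_n -> 'I_n -> 'I_n -> Prop) i j k :
    i < n -> j < n -> k < n ->
    (forall a b c,
       P a b c <-> x a = i :> nat /\ x b = j :> nat /\ x c = k :> nat) ->
  once P.
Proof.
move=> /(perm_preimage x)[a xa] /(perm_preimage x)[b xb].
move=> /(perm_preimage x)[c xc] PE.
exists a, b, c; split=> [|a' b' c' /PE[xa' [xb' xc']]]; first exact/PE.
by split; apply/(@perm_inj _ x)/val_inj => /=; lia.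
Qed.

Lemma graph_moved_one_once x y j : 3 <= j < n -> graph (moved_one j) x y ->
  once (occ132 x y) /\ once (occ321 x y).
Proof.
move=> /andP[j3 jn] g.
have point z := moved_oneE j (x z) j3.
split.
  apply: (once_preimage x _ 0 1 2); try lia.
  move=> a b c; rewrite /occ132 !g.
  by have := point a; have := point b; have := point c; lia.
apply: (once_preimage x _ 1 2 j); try lia.
move=> a b c; rewrite /occ321 !g.
by have := point a; have := point b; have := point c; lia.
Qed.

Lemma graph_42513_once x y : 5 <= n -> graph word42513 x y ->
  once (occ132 x y) /\ once (occ321 x y).
Proof.
move=> n5 g.
have point z := word42513E (x z).
split.
  apply: (once_preimage x _ 1 2 4); try lia.
  move=> a b c; rewrite /occ132 !g.
  by have := point a; have := point b; have := point c; lia.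
apply: (once_preimage x _ 0 1 3); try lia.
move=> a b c; rewrite /occ321 !g.
by have := point a; have := point b; have := point c; lia.
Qed.

Lemma once_swap x y :
  once (occ132 x y) /\ once (occ321 x y) ->
  once (occ132 y x) /\ once (occ321 y x).
Proof.
move=> [[a [b [c o1]]] [d [e [f o2]]]]; split.
  by exists a, c, b; apply: only132_swap.
by exists f, e, d; apply: only321_swap.
Qed.
End Graph.

(** * Counting the permutations with one 132 and one 321 *)

Definition p132 : 'S_3 := tperm (inord 1) (inord 2).
Definition p321 : 'S_3 := rev_perm 3.

Lemma p132E (i : 'I_3) : p132 i = nth 0 [:: 0; 2; 1] i :> nat.
Proof.
rewrite -(inord_val i); case: i => [[|[|[|?]]] ?] //=.
- by rewrite /p132 tpermD ?inordK // -val_eqE /= !inordK.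
- by rewrite tpermL !inordK.
by rewrite tpermR !inordK.
Qed.

Lemma p321E (i : 'I_3) : p321 i = nth 0 [:: 2; 1; 0] i :> nat.
Proof. by rewrite permE; case: i => [[|[|[|?]]] ?]. Qed.

Lemma occurrence_p132 {n} (p : 'S_n) f :
  occurrence p132 p f <-> occ132 1 p (f (inord 0)) (f (inord 1)) (f (inord 2)).
Proof.
rewrite /occ132 !perm1.
split=> [/occurrenceP[incr order] | [incr order]].
  have f01 := incr (inord 0) (inord 1); have f12 := incr (inord 1) (inord 2).
  have p02 := order (inord 2) (inord 0); have p21 := order (inord 1) (inord 2).
  by move: f01 f12 p02 p21; rewrite !p132E !inordK //=; lia.
apply/occurrenceP; split=> i j; rewrite ?p132E -(inord_val i) -(inord_val j);
  by case: i j => [[|[|[|?]]] ?] [[|[|[|?]]] ?] //=; rewrite !inordK //=; lia.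
Qed.

Lemma occurrence_p321 {n} (p : 'S_n) f :
  occurrence p321 p f <-> occ321 1 p (f (inord 0)) (f (inord 1)) (f (inord 2)).
Proof.
rewrite /occ321 !perm1.
split=> [/occurrenceP[incr order] | [incr order]].
  have f01 := incr (inord 0) (inord 1); have f12 := incr (inord 1) (inord 2).
  have p01 := order (inord 0) (inord 1); have p12 := order (inord 1) (inord 2).
  by move: f01 f12 p01 p12; rewrite !p321E !inordK //=; lia.
apply/occurrenceP; split=> i j; rewrite ?p321E -(inord_val i) -(inord_val j);
  by case: i j => [[|[|[|?]]] ?] [[|[|[|?]]] ?] //=; rewrite !inordK //=; lia.
Qed.

Section Count.
Context {n : nat}.
Implicit Types p w : 'S_n.

Lemma graph1P (f : nat -> nat) w p :
  (forall i, w i = f i :> nat) -> graph f 1 p <-> p = w.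
Proof.
move=> wE; split=> [g | -> i]; last by rewrite perm1 wE.
by apply/permP=> i; apply: val_inj; rewrite /= g perm1 wE.
Qed.

Lemma graph1VP (f : nat -> nat) w p :
  (forall i, w i = f i :> nat) -> graph f p 1 <-> p = (w^-1)%g.
Proof.
move=> wE; split=> [g | -> i]; last by rewrite -wE permKV perm1.
rewrite -[p]mulg1 -(mulgV w) mulgA -[RHS]mul1g; congr (_ * _)%g.
by apply/permP=> i; apply: val_inj; rewrite /= g permM wE.
Qed.

Definition moved_ones : {set 'S_n} :=
  [set moved_one_perm (i + 3) | i : 'I_(n - 3)].
Definition moved_onesV : {set 'S_n} :=
  [set (moved_one_perm (i + 3))^-1%g | i : 'I_(n - 3)].
(** This set is empty when n = 4, where the word 42513 has no room. *)
Definition all42513 : {set 'S_n} := [set p | (5 <= n) && (p == perm42513)].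

Lemma once_family p :
  once (occ132 1 p) /\ once (occ321 1 p) <->
  p \in moved_ones :|: moved_onesV :|: all42513.
Proof.
rewrite !inE -orbA.
have dom (i : 'I_(n - 3)) : 3 <= i + 3 < n by have := ltn_ord i; lia.
split=> [[o1 o2] | /or3P[/imsetP[i _ ->] | /imsetP[i _ ->] | /andP[n5 /eqP->]]].
- apply/or3P; case: (once_graph _ _ o1 o2) => [[j j3 g]|[j j3 g]|[n5 g]].
  + constructor 1; apply/imsetP.
    have ltj : j - 3 < n - 3 by lia.
    exists (Ordinal ltj) => //=; rewrite subnK; last by lia.
    exact/(graph1P (moved_one j))/g/moved_one_permE.
  + constructor 2; apply/imsetP.
    have ltj : j - 3 < n - 3 by lia.
    exists (Ordinal ltj) => //=; rewrite subnK; last by lia.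
    exact/(graph1VP (moved_one j))/g/moved_one_permE.
  constructor 3; rewrite n5; apply/eqP.
  exact/(graph1P word42513)/g/perm42513E.
- apply: (graph_moved_one_once _ _ _ (dom i)).
  by apply/(graph1P (moved_one (i + 3))) => //; apply/moved_one_permE/dom.
- apply: once_swap; apply: (graph_moved_one_once _ _ _ (dom i)).
  by apply/(graph1VP (moved_one (i + 3))) => //; apply/moved_one_permE/dom.
apply: (graph_42513_once _ _ n5).
by apply/(graph1P word42513) => //; apply: perm42513E.
Qed.

(** The position of the letter 1 tells the members of the first family apart,
    hence also their inverses; the first two letters tell the three families
    apart. *)
Lemma card_family : 4 <= n ->
  #|moved_ones :|: moved_onesV :|: all42513| = 2 * (n - 3) + (5 <= n).
Proof.
move=> n4.
have dom (i : 'I_(n - 3)) : 3 <= i + 3 < n by have := ltn_ord i; lia.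
have lt0n : 0 < n by lia.
have lt1n : 1 < n by lia.
pose o0 := Ordinal lt0n; pose o1 := Ordinal lt1n.
have moved0 (i : 'I_(n - 3)) : moved_one_perm (i + 3) o0 = 1 :> nat.
  by rewrite (moved_one_permE _ (dom i)).
have movedV0 (i : 'I_(n - 3)) : (moved_one_perm (i + 3))^-1%g o0 = i + 3 :> nat.
  have [_ lt_j] := andP (dom i).
  suff <- : moved_one_perm (i + 3) (Ordinal lt_j) = o0 by rewrite permK.
  apply: val_inj => /=; rewrite (moved_one_permE _ (dom i)) /=.
  by have := @moved_oneE (i + 3) (i + 3); lia.
have movedV1 (i : 'I_(n - 3)) : (moved_one_perm (i + 3))^-1%g o1 = 0 :> nat.
  suff <- : moved_one_perm (i + 3) o0 = o1 by rewrite permK.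
  by apply: val_inj => /=; rewrite moved0.
have cardA : #|moved_ones| = n - 3.
  rewrite card_imset ?card_ord // => i j eq_ij; apply/val_inj/(@addIn 3) => /=.
  by rewrite -(movedV0 i) -(movedV0 j) eq_ij.
have cardV : #|moved_onesV| = n - 3.
  rewrite card_imset ?card_ord // => i j eq_ij; apply/val_inj/(@addIn 3) => /=.
  by rewrite -(movedV0 i) -(movedV0 j) eq_ij.
have disjAV : moved_ones :&: moved_onesV = set0.
  apply/setP=> p; rewrite !inE; apply/andP.
  move=> -[/imsetP[i _ ->] /imsetP[j _ eq_ij]].
  by have := moved0 i; rewrite eq_ij movedV0; lia.
have card42513 : #|all42513| = (5 <= n).
  have [n5 | n5] := leqP 5 n.
    by apply/eqP/cards1P; exists perm42513; apply/setP=> p; rewrite !inE n5.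
  by apply/eqP; rewrite cards_eq0; apply/eqP/setP=> p; rewrite !inE leqNgt n5.
have disjC : (moved_ones :|: moved_onesV) :&: all42513 = set0.
  apply/setP=> p; rewrite !inE; apply/and3P=> -[fam n5 /eqP eq_p].
  have p0 : p o0 = 3 :> nat by rewrite eq_p perm42513E.
  have p1 : p o1 = 1 :> nat by rewrite eq_p perm42513E.
  case/orP: fam => /imsetP[i _ eq_i].
    by have := moved0 i; rewrite -eq_i; lia.
  by have := movedV1 i; rewrite -eq_i; lia.
rewrite cardsU disjC cards0 subn0 cardsU disjAV cards0 subn0.
by rewrite cardA cardV card42513; lia.
Qed.
End Count.

Lemma nb_perms132_321 n : 4 <= n ->
  nb_perms n set0 [set p132; p321] = 2 * (n - 3) + (5 <= n).
Proof.
move=> n4; rewrite -card_family //; apply: eq_card => p; rewrite inE.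
have [o132 o321] := (nb_occurrences1P _ _ _ (occurrence_p132 p),
                     nb_occurrences1P _ _ _ (occurrence_p321 p)).
have -> : [forall a in set0, @nb_occurrences 3 n a p == 0].
  by apply/forall_inP=> a; rewrite inE.
apply/forall_inP/idP => [occ | /once_family[/o132 e132 /o321 e321] a].
  by apply/once_family; split; [apply/o132 | apply/o321];
     apply/eqP/occ; rewrite !inE eqxx ?orbT.
by rewrite !inE => /orP[] /eqP->; apply/eqP.
Qed.

(** * The other pairs of patterns *)

Lemma perm_word3 (a : 'S_3) (w : seq nat) :
  size w = 3 -> (forall i : 'I_3, (a i).+1 = nth 0 w i) -> perm_word a = w.
Proof.
move=> size_w aE.
apply: (@eq_from_nth _ 0) => [|i]; rewrite size_perm_word ?size_w // => lt_i.
by rewrite (nth_perm_word a (Ordinal lt_i)) aE.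
Qed.

Lemma word_p132 : perm_word p132 = [:: 1; 3; 2].
Proof.
by apply: perm_word3 => // i; rewrite p132E; case: i => [[|[|[|?]]] ?].
Qed.

Lemma word_p321 : perm_word p321 = [:: 3; 2; 1].
Proof.
by apply: perm_word3 => // i; rewrite p321E; case: i => [[|[|[|?]]] ?].
Qed.

Lemma nb_perms_pair n (alpha beta : 'S_3) :
    4 <= n ->
    [set alpha; beta] \in
         [:: perms_of_words 3 [:: [:: 1; 2; 3]; [:: 2; 3; 1]];
             perms_of_words 3 [:: [:: 1; 2; 3]; [:: 3; 1; 2]];
             perms_of_words 3 [:: [:: 1; 3; 2]; [:: 3; 2; 1]];
             perms_of_words 3 [:: [:: 2; 1; 3]; [:: 3; 2; 1]]] ->
  nb_perms n set0 [set alpha; beta] = 2 * (n - 3) + (5 <= n).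
Proof.
move=> n4.
have imset2_reversal (a b : 'S_3) :
    reversal @: [set a; b] = [set reversal a; reversal b].
  by rewrite imsetU1 imset_set1.
have imset2_complement (a b : 'S_3) :
    complement @: [set a; b] = [set complement a; complement b].
  by rewrite imsetU1 imset_set1.
have words2 (a b : 'S_3) v w : perm_word a = v -> perm_word b = w ->
    perms_of_words 3 [:: v; w] = [set a; b].
  by move=> <- <-; apply: perms_of_words2.
rewrite -(nb_perms132_321 n n4) !inE => /or4P[] /eqP->.
- (* {123, 231} is the reversal of {132, 321}. *)
  rewrite -(nb_perms_reversal n set0 [set p132; p321]) imset0 imset2_reversal.
  rewrite setUC (words2 (reversal p321) (reversal p132)) //;
  by rewrite perm_word_reversal ?word_p132 ?word_p321.
- (* {123, 312} is its complement. *)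
  rewrite -(nb_perms_complement n set0 [set p132; p321]) imset0.
  rewrite imset2_complement.
  rewrite setUC (words2 (complement p321) (complement p132)) //;
  by rewrite perm_word_complement ?word_p132 ?word_p321.
- by rewrite (words2 p132 p321) ?word_p132 ?word_p321.
(* {213, 321} is the reversal of the complement. *)
rewrite -(nb_perms_complement n set0 [set p132; p321]) imset0.
rewrite imset2_complement.
rewrite -(nb_perms_reversal n set0 [set complement p132; complement p321]).
rewrite imset0 imset2_reversal.
rewrite (words2 (reversal (complement p132)) (reversal (complement p321))) //;
by rewrite perm_word_reversal perm_word_complement ?word_p132 ?word_p321.
Qed.

Theorem theorem5p2 (alpha beta : 'S_3)
  (h : [set alpha; beta] \in
         [:: perms_of_words 3 [:: [:: 1; 2; 3]; [:: 2; 3; 1]];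
             perms_of_words 3 [:: [:: 1; 2; 3]; [:: 3; 1; 2]];
             perms_of_words 3 [:: [:: 1; 3; 2]; [:: 3; 2; 1]];
             perms_of_words 3 [:: [:: 2; 1; 3]; [:: 3; 2; 1]]]) :
  (forall n : nat, 5 <= n -> nb_perms n set0 [set alpha; beta] = 2 * n - 5) /\
  nb_perms 4 set0 [set alpha; beta] = 2.
Proof.
split=> [n n5|]; last exact: nb_perms_pair.
by rewrite nb_perms_pair ?n5 //; lia.
Qed.
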